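(* Let $n,N\ge1$, $T>0$, $\mathbf c\in\mathbb R^n_+$, $\mathbf d\in\mathbb R^n_+$, $C\ge0$ with $d_{i+1}-d_i\le c_{i+1}$ for $i\in[n-1]$. Suppose the support set is the box $\mathcal U=\{\mathbf u\in\mathbb R^n:\mathbf u^{L}\le\mathbf u\le\mathbf u^{U}\}$ with $0\le u^L_i<u^U_i<\infty$ for all $i$, and let $\widehat{\mathbf u}^1,\dots,\widehat{\mathbf u}^N\in\mathcal U$, $\epsilon>0$. (i) If $p=1$, W-DRAS has the same optimal value and the same set of optimal schedules $\mathbf s$ as the linear program $$\min_{\rho,\mathbf s,\boldsymbol\gamma,\mathbf z}\ \epsilon\rho+\frac1N\sum_{j=1}^N\sum_{i=1}^n\gamma_{ij}$$ subject to, for all $i\in[n]$, $\ell\in[i,n+1]_{\mathbb Z}$, $j\in[N]$: $\sum_{k=i}^{\min\{\ell,n\}}\gamma_{kj}\ge\sum_{k=i}^{\min\{\ell,n\}}z_{k\ell j}$; $z_{i\ell j}+\pi_{i\ell}s_i+|u^L_i-\widehat u^j_i|\rho\ge\pi_{i\ell}u^L_i$; $z_{i\ell j}+\pi_{i\ell}s_i\ge\pi_{i\ell}\widehat u^j_i$; $z_{i\ell j}+\pi_{i\ell}s_i+|u^U_i-\widehat u^j_i|\rho\ge\pi_{i\ell}u^U_i$; and $\rho\ge0$, $\mathbf s\in\mathcal S$. (ii) If $p=2$, W-DRAS has the same optimal value and the same set of optimal schedules $\mathbf s$ as the second-order cone program $$\min_{\rho,\mathbf s,\boldsymbol\gamma,\mathbf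 z,\boldsymbol\beta,\mathbf r}\ \epsilon^2\rho+\frac1N\sum_{j=1}^N\sum_{i=1}^n\gamma_{ij}$$ subject to, for all $i\in[n]$, $\ell\in[i,n+1]_{\mathbb Z}$, $j\in[N]$: $\sum_{k=i}^{\min\{\ell,n\}}\gamma_{kj}\ge\sum_{k=i}^{\min\{\ell,n\}}z_{k\ell j}$; $z_{i\ell j}+\pi_{i\ell}s_i-(u^U_i-\widehat u^j_i)\beta^U_{i\ell j}-(\widehat u^j_i-u^L_i)\beta^L_{i\ell j}-r_{i\ell j}\ge\pi_{i\ell}\widehat u^j_i$; $\left\|\begin{bmatrix}\pi_{i\ell}+\beta^L_{i\ell j}-\beta^U_{i\ell j}\\ r_{i\ell j}-\rho\end{bmatrix}\right\|_2\le r_{i\ell j}+\rho$; $\beta^L_{i\ell j}\ge0$, $\beta^U_{i\ell j}\ge0$; and $\rho\ge0$, $\mathbf s\in\mathcal S$.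
   Context: Notation: $[m]=\{1,\dots,m\}$, $[i,j]_{\mathbb Z}=\{i,\dots,j\}$. Schedules: $\mathcal S=\{\mathbf s\in\mathbb R^n:\mathbf s\ge0,\sum_is_i\le T\}$. For $\mathbf s\in\mathcal S,\mathbf u\in\mathbb R^n$, $f(\mathbf s,\mathbf u)$ is the optimal value of $\min_{\mathbf w\in\mathbb R^{n+1},\mathbf v\in\mathbb R^n}\sum_{i=1}^n(c_iw_i+d_iv_i)+Cw_{n+1}$ s.t. $w_i-v_{i-1}=u_{i-1}+w_{i-1}-s_{i-1}$ ($i\in[2,n+1]_{\mathbb Z}$), $\mathbf w\ge0$, $w_1=0$, $\mathbf v\ge0$. For $p\ge1$, $d_p(\mathbb Q_1,\mathbb Q_2)=(\inf_\Pi\mathbb E_\Pi\|\mathbf u_1-\mathbf u_2\|_p^p)^{1/p}$ over couplings $\Pi$ of $\mathbb Q_1,\mathbb Q_2$; $\widehat{\mathbb P}^N=\frac1N\sum_j\delta_{\widehat{\mathbf u}^j}$; $\mathcal D_p(\widehat{\mathbb P}^N,\epsilon)$ is the set of probability distributions $\mathbb Q$ on $\mathcal U$ with $d_p(\mathbb Q,\widehat{\mathbb P}^N)\le\epsilon$; W-DRAS is $\min_{\mathbf s\in\mathcal S}\sup_{\mathbb Q\in\mathcal D_p(\widehat{\mathbb P}^N,\epsilon)}\mathbb E_{\mathbb Q}[f(\mathbf s,\mathbf u)]$. The constants $\pi_{i\ell}$ are: for $i\in[n]$, $\pi_{i\ell}=-d_\ell+\sum_{q=i+1}^{\ell}c_q$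 if $\ell\in[i,n]_{\mathbb Z}$, and $\pi_{i,n+1}=C+\sum_{q=i+1}^nc_q$. *)

(* Defs.v *)
From HB Require Import structures.
From mathcomp Require Import all_boot all_order all_algebra.
From mathcomp Require Import all_classical all_reals all_analysis.
Set Implicit Arguments. Unset Strict Implicit. Unset Printing Implicit Defensive.
Import Order.TTheory GRing.Theory Num.Theory.
Local Open Scope classical_set_scope.
Local Open Scope ring_scope.

(* Conventions: indices are 0-based.  Paper index i in [n] is the ordinal
   i-1 : 'I_n; paper index l in [i, n+1] is the ordinal l-1 : 'I_n.+1
   (so the ordinal n = ord_max stands for the paper's n+1).
   Scenarios u in R^n are n.-tuples (with the product Borel sigma-algebra). *)

Section Defs.
Variable R : realType.
Variable n : nat.

(* decision variables: w : 'I_n.+1 -> R  (w k = paper w_{k+1}),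
                       v : 'I_n -> R     (v k = paper v_{k+1}) *)
Definition recourse_feasible (s : 'I_n -> R) (u : n.-tuple R)
    (w : 'I_n.+1 -> R) (v : 'I_n -> R) : Prop :=
  w ord0 = 0 /\ (forall k, 0 <= w k) /\ (forall k, 0 <= v k) /\
  (forall k : 'I_n,
     w (lift ord0 k) - v k = tnth u k + w (widen_ord (leqnSn n) k) - s k).

Definition recourse_obj (c d : 'I_n -> R) (C : R)
    (w : 'I_n.+1 -> R) (v : 'I_n -> R) : R :=
  \sum_(k < n) (c k * w (widen_ord (leqnSn n) k) + d k * v k) + C * w ord_max.

Definition fcost (c d : 'I_n -> R) (C : R) (s : 'I_n -> R) (u : n.-tuple R) : R :=
  inf [set y | exists w v, recourse_feasible s u w v /\ y = recourse_obj c d C w v].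

Definition schedules (T : R) : set ('I_n -> R) :=
  [set s | (forall i, 0 <= s i) /\ \sum_(i < n) s i <= T].

Definition box (uL uU : 'I_n -> R) : set (n.-tuple R) :=
  [set u | forall i, uL i <= tnth u i <= uU i].

Definition empirical (N : nat) (uhat : 'I_N -> n.-tuple R)
    (A : set (n.-tuple R)) : \bar R :=
  ((N%:R)^-1)%:E * (\sum_(j < N) \d_(uhat j) A)%E.

Definition coupling (Q1 Q2 : set (n.-tuple R) -> \bar R)
    (Pi : probability (n.-tuple R * n.-tuple R)%type R) : Prop :=
  forall A : set (n.-tuple R), measurable A ->
    Pi (A `*` setT) = Q1 A /\ Pi (setT `*` A) = Q2 A.

Definition pcost (p : R) (xy : n.-tuple R * n.-tuple R) : R :=
  \sum_(i < n) `|tnth xy.1 i - tnth xy.2 i| `^ p.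

Definition wasserstein (p : R) (Q1 Q2 : set (n.-tuple R) -> \bar R) : \bar R :=
  poweR (ereal_inf [set (\int[Pi]_xy (pcost p xy)%:E)%E
                    | Pi in [set Pi | coupling Q1 Q2 Pi]]) p^-1.

Definition ambiguity (p eps : R) (uL uU : 'I_n -> R) (N : nat)
    (uhat : 'I_N -> n.-tuple R) : set (probability (n.-tuple R) R) :=
  [set Q | Q (box uL uU) = 1%E /\
           (wasserstein p Q (empirical uhat) <= eps%:E)%E].

Definition wdras_obj (c d : 'I_n -> R) (C p eps : R) (uL uU : 'I_n -> R)
    (N : nat) (uhat : 'I_N -> n.-tuple R) (s : 'I_n -> R) : \bar R :=
  ereal_sup [set (\int[Q]_u (fcost c d C s u)%:E)%E
             | Q in ambiguity p eps uL uU uhat].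

Definition wdras_value (c d : 'I_n -> R) (C p eps : R) (uL uU : 'I_n -> R) (N : nat) (uhat : 'I_N -> n.-tuple R) (T : R) : \bar R :=
  ereal_inf [set wdras_obj c d C p eps uL uU uhat s | s in schedules T].

Definition wdras_optimal (c d : 'I_n -> R) (C p eps : R) (uL uU : 'I_n -> R) (N : nat) (uhat : 'I_N -> n.-tuple R) (T : R) : set ('I_n -> R) :=
  [set s | schedules T s /\
           wdras_obj c d C p eps uL uU uhat s = @wdras_value c d C p eps uL uU N uhat T].

Definition pi_coef (c d : 'I_n -> R) (C : R) (i : 'I_n) (l : 'I_n.+1) : R :=
  match unlift ord_max l with
  | Some l' => - d l' + \sum_(q < n | (i < q <= l')%N) c q
  | None => C + \sum_(q < n | (i < q)%N) c q
  end.

Definition lp1_feasible (c d : 'I_n -> R) (C T : R) (uL uU : 'I_n -> R) (N : nat)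
    (uhat : 'I_N -> n.-tuple R) (rho : R) (s : 'I_n -> R)
    (gam : 'I_n -> 'I_N -> R) (z : 'I_n -> 'I_n.+1 -> 'I_N -> R) : Prop :=
  (forall (i : 'I_n) (l : 'I_n.+1) (j : 'I_N), (i <= l)%N ->
     [/\ \sum_(k < n | (i <= k <= l)%N) gam k j >=
           \sum_(k < n | (i <= k <= l)%N) z k l j,
         z i l j + pi_coef c d C i l * s i + `|uL i - tnth (uhat j) i| * rho
           >= pi_coef c d C i l * uL i,
         z i l j + pi_coef c d C i l * s i >= pi_coef c d C i l * tnth (uhat j) i
       & z i l j + pi_coef c d C i l * s i + `|uU i - tnth (uhat j) i| * rho
           >= pi_coef c d C i l * uU i]) /\
  0 <= rho /\ schedules T s.

Definition lp1_obj (eps : R) (N : nat) (rho : R) (gam : 'I_n -> 'I_N -> R) : R :=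
  eps * rho + (N%:R)^-1 * \sum_(j < N) \sum_(i < n) gam i j.

Definition lp1_value (c d : 'I_n -> R) (C T : R) (uL uU : 'I_n -> R) (N : nat) (uhat : 'I_N -> n.-tuple R) (eps : R) : \bar R :=
  ereal_inf [set y | exists rho s gam z,
     @lp1_feasible c d C T uL uU N uhat rho s gam z /\ y = (lp1_obj eps rho gam)%:E].

Definition lp1_optimal (c d : 'I_n -> R) (C T : R) (uL uU : 'I_n -> R) (N : nat) (uhat : 'I_N -> n.-tuple R) (eps : R) : set ('I_n -> R) :=
  [set s | exists rho gam z,
     @lp1_feasible c d C T uL uU N uhat rho s gam z /\
     (lp1_obj eps rho gam)%:E = @lp1_value c d C T uL uU N uhat eps].

Definition socp2_feasible (c d : 'I_n -> R) (C T : R) (uL uU : 'I_n -> R) (N : nat)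
    (uhat : 'I_N -> n.-tuple R) (rho : R) (s : 'I_n -> R)
    (gam : 'I_n -> 'I_N -> R) (z bL bU r : 'I_n -> 'I_n.+1 -> 'I_N -> R) : Prop :=
  (forall (i : 'I_n) (l : 'I_n.+1) (j : 'I_N), (i <= l)%N ->
     [/\ \sum_(k < n | (i <= k <= l)%N) gam k j >=
           \sum_(k < n | (i <= k <= l)%N) z k l j,
         z i l j + pi_coef c d C i l * s i
           - (uU i - tnth (uhat j) i) * bU i l j
           - (tnth (uhat j) i - uL i) * bL i l j - r i l j
           >= pi_coef c d C i l * tnth (uhat j) i,
         Num.sqrt ((pi_coef c d C i l + bL i l j - bU i l j) ^+ 2
                   + (r i l j - rho) ^+ 2) <= r i l j + rho,
         0 <= bL i l j
       & 0 <= bU i l j]) /\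
  0 <= rho /\ schedules T s.

Definition socp2_obj (eps : R) (N : nat) (rho : R) (gam : 'I_n -> 'I_N -> R) : R :=
  eps ^+ 2 * rho + (N%:R)^-1 * \sum_(j < N) \sum_(i < n) gam i j.

Definition socp2_value (c d : 'I_n -> R) (C T : R) (uL uU : 'I_n -> R) (N : nat) (uhat : 'I_N -> n.-tuple R) (eps : R) : \bar R :=
  ereal_inf [set y | exists rho s gam z bL bU r,
     @socp2_feasible c d C T uL uU N uhat rho s gam z bL bU r /\
     y = (socp2_obj eps rho gam)%:E].

Definition socp2_optimal (c d : 'I_n -> R) (C T : R) (uL uU : 'I_n -> R) (N : nat) (uhat : 'I_N -> n.-tuple R) (eps : R) : set ('I_n -> R) :=
  [set s | exists rho gam z bL bU r,
     @socp2_feasible c d C T uL uU N uhat rho s gam z bL bU r /\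
     (socp2_obj eps rho gam)%:E = @socp2_value c d C T uL uU N uhat eps].

End Defs.

(* Main.v *)
(* For a fixed schedule s, linear programming duality writes the recourse cost
   f(s,u) as the maximum, over the partitions of [1,n+1] into blocks [i,l], of
   the sum of pi_{kl} (u_k - s_k).  Once the partition is fixed, the penalised
   cost f(s,u) - rho |u - uhat|_p^p splits over the coordinates, so its maximum
   over the box is a longest path whose arc lengths are sums of one-dimensional
   maxima z_{kl}; the gamma_k are the differences of the dual potentials.

   Weak duality integrates f(s,u) <= rho |u - uhat^j|_p^p + sum_k gamma_{kj}
   against a nearly optimal coupling.  For strong duality, let V be the worst
   case expectation and plot, for every choice of one scenario u^j in the box
   per sample, the point (mean transport cost, mean recourse cost).  A mixture
   of two such choices is a discrete distribution, so no chord of the plot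
   exceeds V at abscissa eps^p.  A supporting line there has a slope rho >= 0
   at which the program attains V; since the minimum over rho is attained for
   every s, the optimal schedules agree as well. *)
Require Import Defs.
From HB Require Import structures.
From mathcomp Require Import all_boot all_order all_algebra.
From mathcomp Require Import all_classical all_reals all_analysis.
From mathcomp Require Import measurable_realfun zify ring lra.
Import Order.TTheory GRing.Theory Num.Theory.
Local Open Scope classical_set_scope.
Local Open Scope ring_scope.

(** * Partitions into blocks and longest paths *)

Section Partitions.
Variables (R : realFieldType) (n : nat).
Implicit Types (E : nat -> bool) (Z : nat -> nat -> R) (g : nat -> R).

(** [E] marks the last index of each block. [find] returns the length of the list when nothing is
    marked, so an unfinished block ends at [n], the extra index after the last coordinate. *)
Definition block_end E k : nat := (k + find E (iota k (n - k)))%N.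

Lemma block_end_ge E k : (k <= block_end E k)%N.
Proof. exact: leq_addr. Qed.

Lemma block_end_le E k : (k <= n)%N -> (block_end E k <= n)%N.
Proof.
move=> kn; rewrite /block_end.
have := find_size E (iota k (n - k)); rewrite size_iota; lia.
Qed.

Lemma block_end_stop E k : (k < n)%N -> E k -> block_end E k = k.
Proof.
by move=> kn Ek; rewrite /block_end -(subnSK kn) /= Ek addn0.
Qed.

Lemma block_end_next E k : (k < n)%N -> ~~ E k ->
  block_end E k = block_end E k.+1.
Proof.
by move=> kn /negbTE Ek; rewrite /block_end -(subnSK kn) /= Ek addSnnS.
Qed.

Lemma block_end_last E : block_end E n = n.
Proof. by rewrite /block_end subnn addn0. Qed.

Lemma block_end_in E i k : (i <= k <= block_end E i)%N -> (i <= n)%N ->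
  block_end E k = block_end E i.
Proof.
move=> /andP[ik kL] iN; elim: k ik kL => [|k IH]; first by case: i iN.
rewrite leq_eqVlt => /predU1P[<- //|ik] kL.
have kn : (k < n)%N := leq_trans kL (block_end_le E i iN).
rewrite -(IH ik (ltnW kL)); case: (boolP (E k)) => [Ek|nEk]; last first.
  by rewrite -block_end_next.
by move: (kL); rewrite -(IH ik (ltnW kL)) block_end_stop // ltnn.
Qed.

Lemma eq_block_end E E' i : (forall k, (i <= k < n)%N -> E k = E' k) ->
  block_end E i = block_end E' i.
Proof.
move=> EE'; rewrite /block_end; congr (_ + _)%N; apply: eq_in_find => k.
rewrite mem_iota => kI; apply: EE'; lia.
Qed.

(** Cut both sums along the blocks and add the hypothesis over them, peeling off the first block.
    The [minn] is there because a block ending at [n] has no summand at [n]. *)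
Lemma partition_bound E Z g :
  (forall i l, (i <= l <= n)%N -> (i < n)%N ->
     \sum_(i <= k < minn l.+1 n) Z k l <= \sum_(i <= k < minn l.+1 n) g k) ->
  \sum_(0 <= k < n) Z k (block_end E k) <= \sum_(0 <= k < n) g k.
Proof.
move=> H.
have: forall m i, (n - i <= m)%N ->
    \sum_(i <= k < n) Z k (block_end E k) <= \sum_(i <= k < n) g k.
  elim=> [|m IH] i mi; first by rewrite !big_geq //; lia.
  have [ni|iltn] := leqP n i; first by rewrite !big_geq.
  set l := block_end E i.
  have il : (i <= l)%N by exact: block_end_ge.
  have ln : (l <= n)%N by apply: block_end_le; exact: ltnW.
  have imin : (i <= minn l.+1 n)%N by lia.
  have minn_n : (minn l.+1 n <= n)%N by lia.
  rewrite (big_cat_nat imin minn_n) (big_cat_nat (F := g) imin minn_n) /=.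
  apply: lerD; last by apply: IH; lia.
  rewrite (eq_big_nat _ _ (F2 := fun k => Z k l)); last first.
    by move=> k kI; rewrite (@block_end_in E i) //; lia.
  by apply: H => //; lia.
by move=> /(_ n 0); apply; rewrite subn0.
Qed.

(** Marks on ['I_n] form a finite type, over which a best partition can be picked by [arg max]. *)
Definition indicator_ext (e : {ffun 'I_n -> bool}) (k : nat) : bool :=
  if insub k is Some i then e i else false.

Lemma indicator_extE (F : nat -> bool) k : (k < n)%N ->
  indicator_ext [ffun i : 'I_n => F i] k = F k.
Proof. by move=> kn; rewrite /indicator_ext insubT ffunE. Qed.

(** Longest-path duality, the converse of [partition_bound]: [lam i] is the largest weight of a
    partition of the indices from [i] on, and [g] is the decrement of [lam]. *)
Lemma partition_potential Z : exists E g,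
  (forall i l, (i <= l <= n)%N ->
     \sum_(i <= k < minn l.+1 n) Z k l <= \sum_(i <= k < minn l.+1 n) g k) /\
  \sum_(0 <= k < n) g k = \sum_(0 <= k < n) Z k (block_end E k).
Proof.
pose S i E := \sum_(i <= k < n) Z k (block_end E k).
pose best i := [arg max_(e > [ffun=> false] : {ffun 'I_n -> bool})
                 S i (indicator_ext e)]%O.
pose lam i := S i (indicator_ext (best i)).
have lam_max i E : S i E <= lam i.
  have -> : S i E = S i (indicator_ext [ffun j : 'I_n => E j]).
    apply: eq_big_nat => k /andP[ik kn]; congr (Z k _).
    by apply: eq_block_end => q /andP[_ qn]; rewrite indicator_extE.
  rewrite /lam /best; case: arg_maxP => // e _; exact.
have lamn i : (n <= i)%N -> lam i = 0 by move=> ni; rewrite /lam /S big_geq.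
have tele i j : (i <= j)%N ->
    \sum_(i <= k < j) (lam k - lam k.+1) = lam i - lam j.
  move=> ij; rewrite -[RHS]opprB -(telescope_sumr _ ij) -sumrN.
  by apply: eq_bigr => k _; rewrite opprB.
exists (indicator_ext (best 0)), (fun k => lam k - lam k.+1); split; last first.
  by rewrite tele // (lamn n) // subr0.
move=> i l /andP[il ln].
have [ni|iltn] := leqP n i; first by rewrite !big_geq //; lia.
have imin : (i <= minn l.+1 n)%N by lia.
have minn_n : (minn l.+1 n <= n)%N by lia.
rewrite tele // lerBrDr.
pose m := minn l.+1 n.
(* Bellman's principle: the competitor for [lam i] is the block from [i] to [l] followed by a best
   partition from [m]. If [l = n], nothing is marked below [m] and the block ends at [n] by
   default. *)
pose E k := if (k < m)%N then k == l else indicator_ext (best m) k.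
apply: le_trans (lam_max i E).
rewrite /S (big_cat_nat imin minn_n) /=; apply: lerD.
  rewrite (eq_big_nat _ _ (F2 := fun k => Z k (block_end E k))) // => k kI.
  congr (Z k _); apply/esym.
  have : forall q, (k + q = l)%N -> block_end E k = l.
    move=> q; elim: q k kI => [|q IH] k kI kq.
      rewrite addn0 in kq; rewrite -kq block_end_stop //; first by lia.
      by rewrite /E kq eqxx; case: ifP => //; lia.
    have kn : (k < n)%N by lia.
    rewrite block_end_next //; last by rewrite /E ifT; lia.
    have [kn1|kn1] := eqVneq k.+1 n; first by rewrite kn1 block_end_last; lia.
    by apply: IH; lia.
  by move=> /(_ (l - k)%N); apply; lia.
rewrite /lam /S; apply: ler_sum_nat => k /andP[mk kn].
rewrite le_eqVlt; apply/orP; left; apply/eqP; congr (Z k _).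
by apply: eq_block_end => q qI; rewrite /E ifF //; lia.
Qed.

End Partitions.

(** * The recourse linear program and its dual *)

Section Recourse.
Variables (R : realFieldType) (n : nat) (c d : nat -> R).
Implicit Types (x w v y : nat -> R) (E : nat -> bool).

(** The dual variable at [i] in the dual solution whose block containing [i] ends at [l]. *)
Definition multiplier i l : R := - d l + \sum_(i.+1 <= q < l.+1) c q.

Lemma multiplier_diag i : multiplier i i = - d i.
Proof. by rewrite /multiplier big_geq ?addr0. Qed.

Lemma multiplier_step i l : (i < l)%N ->
  multiplier i l = multiplier i.+1 l + c i.+1.
Proof.
by move=> il; rewrite /multiplier big_ltn ?ltnS// addrCA addrC.
Qed.

Definition recourse_dynamics x w v :=
  w 0%N = 0 /\ forall k, (k < n)%N -> w k.+1 - v k = x k + w k.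

(** Weak duality with its gap written out: the last sum pairs each primal variable with its dual
    slack. It comes from summation by parts, whose boundary terms vanish because [w 0] and [y n]
    do. *)
Lemma recourse_gap x w v y : recourse_dynamics x w v -> y n = 0 ->
  \sum_(0 <= k < n) (c k.+1 * w k.+1 + d k * v k) =
  \sum_(0 <= k < n) y k * x k +
  \sum_(0 <= k < n) (w k.+1 * (c k.+1 - y k + y k.+1) + v k * (d k + y k)).
Proof.
move=> [w0 wv] yn.
have tele : \sum_(0 <= k < n) (y k.+1 * w k.+1 - y k * w k) = 0.
  by rewrite telescope_sumr // yn w0 mul0r mulr0 subr0.
apply/eqP; rewrite -subr_eq0 -big_split /= -sumrB -[eqbRHS]oppr0 -[X in - X]tele -sumrN.
apply/eqP; apply: eq_big_nat => k kn.
have -> : x k = w k.+1 - v k - w k by rewrite wv ?addrK.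
ring.
Qed.

Section DualFeasible.
Hypothesis dc : forall k, (k < n)%N -> d k.+1 - d k <= c k.+1.

(** First half of dual feasibility. Inside a block, a step to the left adds [c k.+1], which by [dc]
    is at least the change from [- d k.+1] to [- d k]. *)
Lemma multiplier_lower E k : (k <= n)%N ->
  - d k <= multiplier k (block_end n E k).
Proof.
have [m] := ubnP (n - k); elim: m k => // m IH k mk.
rewrite leq_eqVlt => /predU1P[->|kn].
  by rewrite block_end_last multiplier_diag.
have [Ek|nEk] := boolP (E k); first by rewrite block_end_stop ?multiplier_diag.
rewrite block_end_next// multiplier_step ?block_end_ge//.
have := IH k.+1 ltac:(lia) kn; have := dc k kn; lra.
Qed.

(** Second half of dual feasibility: an equality inside a block, and at a block end a consequence of
    [multiplier_lower] at [k.+1]. *)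
Lemma multiplier_upper E k : (k < n)%N ->
  multiplier k (block_end n E k) <= multiplier k.+1 (block_end n E k.+1) + c k.+1.
Proof.
move=> kn; have [Ek|nEk] := boolP (E k); last first.
  by rewrite (block_end_next _ _ _ kn nEk) multiplier_step ?block_end_ge.
rewrite block_end_stop ?multiplier_diag//.
have := multiplier_lower E k.+1 kn; have := dc k kn; lra.
Qed.

Lemma recourse_lower x w v E : recourse_dynamics x w v -> d n = 0 ->
  (forall k, 0 <= w k) -> (forall k, 0 <= v k) ->
  \sum_(0 <= k < n) multiplier k (block_end n E k) * x k <=
  \sum_(0 <= k < n) (c k.+1 * w k.+1 + d k * v k).
Proof.
move=> dyn dn w0 v0.
rewrite (recourse_gap x w v (fun k => multiplier k (block_end n E k)))//; last first.
  by rewrite block_end_last multiplier_diag dn oppr0.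
rewrite lerDl big_nat sumr_ge0 // => k /andP[_ kn]; rewrite addr_ge0 ?mulr_ge0//.
  by have := multiplier_upper E k kn; lra.
by have := multiplier_lower E k (ltnW kn); lra.
Qed.

End DualFeasible.

(** Lindley's recursion: the waiting times of the greedy policy, which idles only when no work is
    left. *)
Fixpoint backlog x k : R :=
  if k is k'.+1 then Num.max 0 (x k' + backlog x k') else 0.

Definition idle x k : R := backlog x k.+1 - (x k + backlog x k).

Lemma backlog_ge0 x k : 0 <= backlog x k.
Proof. by case: k => //= k; rewrite le_max lexx. Qed.

Lemma idle_ge0 x k : 0 <= idle x k.
Proof. by rewrite /idle subr_ge0 /= le_max lexx orbT. Qed.

Lemma backlog_dynamics x : recourse_dynamics x (backlog x) (idle x).
Proof. by split=> // k kn; rewrite /idle opprB addrC subrK. Qed.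

(* The blocks are the busy periods of the greedy policy, so complementary
   slackness makes the duality gap vanish. *)
Lemma backlog_cost x : d n = 0 -> exists E,
  \sum_(0 <= k < n) (c k.+1 * backlog x k.+1 + d k * idle x k) =
  \sum_(0 <= k < n) multiplier k (block_end n E k) * x k.
Proof.
move=> dn; pose E k := backlog x k.+1 == 0; exists E.
rewrite (recourse_gap _ _ _ (fun k => multiplier k (block_end n E k))
  (backlog_dynamics x)); last by rewrite block_end_last multiplier_diag dn oppr0.
rewrite [X in _ + X]big1_seq ?addr0 // => k; rewrite mem_index_iota => /andP[_ kn].
have [Ek|nEk] := boolP (E k).
  by rewrite block_end_stop // multiplier_diag (eqP Ek) mul0r add0r subrr mulr0.
rewrite (block_end_next _ _ _ kn nEk) multiplier_step ?block_end_ge// opprD addrC.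
have -> : idle x k = 0.
  move: nEk; rewrite /E /idle /=; case: leP => [le0|]; last by rewrite eqxx.
  by rewrite subrr.
ring.
Qed.

End Recourse.

(** * The recourse cost *)

Section RecourseCost.
Variables (R : realType) (n : nat).
Implicit Types (x : 'I_n -> R) (a : R).

(** Passing to functions on [nat] lets sums be cut and shifted; [a] is the value from [n] on. *)
Definition extend x a (k : nat) : R := oapp x a (insub k).

Lemma extend_ord x a (i : 'I_n) : extend x a i = x i.
Proof. by rewrite /extend valK. Qed.

Lemma extend_lt x a k (kn : (k < n)%N) : extend x a k = x (Ordinal kn).
Proof. by rewrite -(extend_ord x a). Qed.

Lemma extend_out x a k : (n <= k)%N -> extend x a k = a.
Proof. by move=> nk; rewrite /extend insubN // -leqNgt. Qed.

Lemma sum_ord_range (F : nat -> R) i m : (m <= n)%N ->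
  \sum_(k < n | (i <= k < m)%N) F k = \sum_(i <= k < m) F k.
Proof.
move=> mn; rewrite -(big_mkord (fun k => i <= k < m)%N F).
have [im|mi] := leqP i m; last first.
  rewrite [RHS]big_geq ?(ltnW mi)// big1_seq // => k /andP[/andP[ik km]]; lia.
rewrite (big_cat_nat (leq0n i) (leq_trans im mn)) /=.
rewrite (big_cat_nat im mn) /= big1_seq ?add0r; last first.
  by move=> k; rewrite mem_index_iota; lia.
rewrite [X in _ + X]big1_seq ?addr0; last first.
  by move=> k; rewrite mem_index_iota; lia.
rewrite big_nat_cond [RHS]big_nat_cond; apply: eq_bigl => k.
by rewrite andbT andbb.
Qed.

Lemma sum_block (F : nat -> R) i l :
  \sum_(k < n | (i <= k <= l)%N) F k = \sum_(i <= k < minn l.+1 n) F k.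
Proof.
rewrite -sum_ord_range ?geq_minr//; apply: eq_bigl => k.
by rewrite leq_min ltn_ord andbT ltnS.
Qed.

Variables (c d : 'I_n -> R) (C : R).

(* The paper's job n+1 has index n: with waiting cost [C] and idling cost [0]
   there, both cases of [pi_coef] become the same formula. *)
Definition price i l : R := multiplier R (extend c C) (extend d 0) i l.

Lemma pi_coefE (i : 'I_n) (l : 'I_n.+1) : (i <= l)%N ->
  pi_coef c d C i l = price i l.
Proof.
move=> il; rewrite /pi_coef /price /multiplier.
case: unliftP il => [l' ->|->] il.
  rewrite !lift_max extend_ord; congr (_ + _).
  rewrite -(sum_ord_range (extend c C)) //.
  by apply: eq_bigr => q _; rewrite extend_ord.
rewrite extend_out// oppr0 add0r big_nat_recr //= addrC extend_out//.
congr (_ + _); rewrite -(sum_ord_range (extend c C)) //.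
by apply: eq_big => q; rewrite ?ltn_ord ?andbT// extend_ord.
Qed.

Hypothesis c0 : forall i, 0 <= c i.
Hypothesis d0 : forall i, 0 <= d i.
Hypothesis C0 : 0 <= C.
Hypothesis dc : forall i i' : 'I_n, nat_of_ord i' = (nat_of_ord i).+1 ->
  d i' - d i <= c i'.

(** At the last [k] the next values are [C] and [0], and the inequality reads [- d k <= C]. *)
Lemma extend_dc k : (k < n)%N ->
  extend d 0 k.+1 - extend d 0 k <= extend c C k.+1.
Proof.
move=> kn; have [kn1|] := ltnP k.+1 n.
  by rewrite !extend_lt; apply: dc.
move=> nk; rewrite !(extend_out _ _ _ nk) extend_lt.
by rewrite sub0r (le_trans _ C0)// oppr_le0.
Qed.

Definition excess (s : 'I_n -> R) (u : n.-tuple R) k : R :=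
  extend (tnth u) 0 k - extend s 0 k.

Definition greedy_cost s u : R :=
  \sum_(0 <= k < n) (extend c C k.+1 * backlog R (excess s u) k.+1 +
                     extend d 0 k * idle R (excess s u) k).

(** The term at [w 0] vanishes, so the waiting costs can be shifted by one, which absorbs [C * w n]
    as the last summand. *)
Lemma recourse_objE (w v : nat -> R) : w 0%N = 0 ->
  recourse_obj c d C (fun i : 'I_n.+1 => w i) (fun i : 'I_n => v i) =
  \sum_(0 <= k < n) (extend c C k.+1 * w k.+1 + extend d 0 k * v k).
Proof.
move=> w0; rewrite /recourse_obj !big_split /= addrAC; congr (_ + _); last first.
  by rewrite big_mkord; apply: eq_bigr => k _; rewrite extend_ord.
transitivity (\sum_(0 <= k < n.+1) extend c C k * w k).
  rewrite big_nat_recr //= extend_out// big_mkord; congr (_ + _).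
  by apply: eq_bigr => k _; rewrite extend_ord.
by rewrite big_nat_recl //= w0 mulr0 add0r.
Qed.

Lemma fcost_set_ge s u E y :
  (exists w v, recourse_feasible s u w v /\ y = recourse_obj c d C w v) ->
  \sum_(0 <= k < n) price k (block_end n E k) * excess s u k <= y.
Proof.
move=> [w [v [[w0 [wpos [vpos dyn]]] ->]]].
pose w' k := if insub k is Some i then w i else 0 : R.
have w'E (i : 'I_n.+1) : w' i = w i by rewrite /w' valK.
have -> : w = fun i : 'I_n.+1 => w' i by apply/funext => i; rewrite w'E.
have -> : v = fun i : 'I_n => extend v 0 i.
  by apply/funext => i; rewrite extend_ord.
have w'0 : w' 0%N = 0 by rewrite -[0%N]/(val (@ord0 n)) w'E.
rewrite recourse_objE//; apply: recourse_lower.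
- exact: extend_dc.
- split=> // k kn; rewrite /excess !extend_lt -/(val (Ordinal kn)).
  have := dyn (Ordinal kn); rewrite -!w'E lift0 /= => ->; ring.
- exact: extend_out.
- by move=> k; rewrite /w'; case: insub.
- by move=> k; rewrite /extend; case: insub => //=.
Qed.

Lemma greedy_feasible s u : exists w v,
  recourse_feasible s u w v /\ greedy_cost s u = recourse_obj c d C w v.
Proof.
have [w0 dyn] := backlog_dynamics R n (excess s u).
exists (fun i : 'I_n.+1 => backlog R (excess s u) i),
  (fun i : 'I_n => idle R (excess s u) i); split; last first.
  by rewrite recourse_objE.
split=> //; split=> [k|]; first exact: backlog_ge0.
split=> [k|k]; first exact: idle_ge0.
rewrite lift0 dyn // /excess !extend_ord /=; ring.
Qed.

Lemma greedy_blocks s u : exists E, greedy_cost s u =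
  \sum_(0 <= k < n) price k (block_end n E k) * excess s u k.
Proof. by apply: backlog_cost; exact: extend_out. Qed.

(** The greedy cost is attained by a feasible pair and equals one block sum, and every block sum is
    below every feasible cost. *)
Lemma fcostE s u : fcost c d C s u = greedy_cost s u.
Proof.
have [E gE] := greedy_blocks s u.
apply/eqP; rewrite eq_le /fcost; apply/andP; split.
  apply: ge_inf; last exact: greedy_feasible.
  by exists (greedy_cost s u) => y /fcost_set_ge; rewrite gE; apply.
apply: lb_le_inf; first by exists (greedy_cost s u); exact: greedy_feasible.
by move=> y /fcost_set_ge; rewrite gE; apply.
Qed.

Lemma fcost_ge_blocks s u E :
  \sum_(0 <= k < n) price k (block_end n E k) * excess s u k <= fcost c d C s u.
Proof. by rewrite fcostE; apply: fcost_set_ge; exact: greedy_feasible. Qed.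

Lemma fcost_blocks s u : exists E, fcost c d C s u =
  \sum_(0 <= k < n) price k (block_end n E k) * excess s u k.
Proof. by rewrite fcostE; exact: greedy_blocks. Qed.

Lemma extend_ge0 x a k : (forall i, 0 <= x i) -> 0 <= a -> 0 <= extend x a k.
Proof. by move=> x0 a0; rewrite /extend; case: insub => /=. Qed.

Lemma fcost_ge0 s u : 0 <= fcost c d C s u.
Proof.
rewrite fcostE; apply: sumr_ge0 => k _; apply: addr_ge0; apply: mulr_ge0.
- exact: extend_ge0.
- exact: backlog_ge0.
- exact: extend_ge0.
- exact: idle_ge0.
Qed.

Lemma measurable_excess s k :
  measurable_fun setT (fun u : n.-tuple R => excess s u k).
Proof.
rewrite /excess; apply: measurable_funB => //.
have [kn|nk] := ltnP k n.
  rewrite (_ : (fun u => _) = (fun u : n.-tuple R => tnth u (Ordinal kn))).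
    exact: measurable_tnth.
  by apply/funext => u; rewrite extend_lt.
rewrite (_ : (fun u => _) = cst 0) //.
by apply/funext => u; rewrite extend_out.
Qed.

Lemma measurable_backlog s k :
  measurable_fun setT (fun u : n.-tuple R => backlog R (excess s u) k).
Proof.
elim: k => [|k IH] //=.
apply: measurable_maxr => //; apply: measurable_funD => //.
exact: measurable_excess.
Qed.

(** The greedy form replaces the infimum by finitely many sums and maxima. *)
Lemma measurable_fcost s :
  measurable_fun setT (fun u : n.-tuple R => fcost c d C s u).
Proof.
rewrite (_ : (fun u => _) = greedy_cost s); last first.
  by apply/funext => u; rewrite fcostE.
apply: measurable_sum => k; apply: measurable_funD; apply: measurable_funM => //.
  exact: measurable_backlog.
apply: measurable_funB; first exact: measurable_backlog.
apply: measurable_funD; first exact: measurable_excess.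
exact: measurable_backlog.
Qed.

End RecourseCost.

(** * Discrete distributions and transport cost *)

Lemma discrete_probability (R : realType) (dsp : measure_display)
    (T : measurableType dsp) (I : finType) (w : I -> R) (a : I -> T) :
  (forall i, 0 <= w i) -> \sum_i w i = 1 ->
  exists P : probability T R,
    (forall A, P A = (\sum_i (w i)%:E * \d_(a i) A)%E) /\
    (forall f : T -> R, measurable_fun setT f -> (forall x, 0 <= f x) ->
       (\int[P]_x (f x)%:E = (\sum_i w i * f (a i))%:E)%E).
Proof.
move=> w0 w1.
(* [msum] takes a sequence of measures, so [I] is enumerated and the sequence is padded with zero
   measures. *)
pose m (k : nat) : {measure set T -> \bar R} :=
  if insub k is Some i then
    mscale (NngNum (w0 (enum_val (i : 'I_#|I|)))) (\d_(a (enum_val i)))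
  else mzero.
pose mu : {measure set T -> \bar R} := msum m #|I|.
have mE (i : 'I_#|I|) : m i = mscale (NngNum (w0 (enum_val i))) (\d_(a (enum_val i))).
  by rewrite /m valK.
have muE A : mu A = (\sum_i (w i)%:E * \d_(a i) A)%E.
  rewrite /mu /msum /= [RHS]big_enum_val /=; apply: eq_bigr => i _.
  by rewrite mE.
have mu1 : mu setT = 1%E.
  rewrite muE -[RHS]/(1%R%:E) -w1 -sumEFin; apply: eq_bigr => i _.
  by rewrite diracT mule1.
pose P : probability T R := HB.pack (Measure.sort mu)
   (Measure_isProbability.Build _ _ _ (Measure.sort mu) mu1).
exists P; split=> // f mf f0.
have mEf : measurable_fun setT (EFin \o f) by exact/measurable_EFinP.
have Ef0 x : setT x -> (0 <= (f x)%:E)%E by rewrite lee_fin.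
rewrite -[LHS]/(\int[mu]_x (f x)%:E)%E ge0_integral_measure_sum // -sumEFin.
rewrite [RHS]big_enum_val /=; apply: eq_bigr => i _.
by rewrite mE ge0_integral_mscale // integral_dirac // diracT mul1e.
Qed.

Section Transport.
Variables (R : realType) (n N : nat).
Implicit Types (x y u : n.-tuple R) (uhat : 'I_N -> n.-tuple R).

Lemma measurable_tuple1 u : measurable [set u].
Proof.
have -> : [set u] =
    \big[setI/setT]_(i < n) ((fun x => tnth x i) @^-1` [set tnth u i]).
  rewrite -bigcap_seq; apply/seteqP; split=> [_ -> //|x xu].
  by apply: eq_from_tnth => i; apply: xu; rewrite /= mem_index_enum.
apply: bigsetI_measurable => i _; rewrite -[X in measurable X]setTI.
exact: measurable_tnth.
Qed.

Lemma measurable_box (uL uU : 'I_n -> R) : measurable (box uL uU).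
Proof.
have -> : box uL uU =
    \big[setI/setT]_(i < n) ((fun x => tnth x i) @^-1` `[uL i, uU i]).
  rewrite -bigcap_seq; apply/seteqP; split=> x xB i /=.
    by move=> _; rewrite in_itv /=; exact: xB.
  by have := xB i; rewrite /= in_itv; apply; rewrite mem_index_enum.
apply: bigsetI_measurable => i _; rewrite -[X in measurable X]setTI.
by apply: measurable_tnth => //; exact: measurable_itv.
Qed.

Lemma measurable_atoms uhat : measurable [set y | exists j, y = uhat j].
Proof.
have -> : [set y | exists j, y = uhat j] =
    \big[setU/set0]_(j < N) [set uhat j].
  rewrite -bigcup_seq; apply/seteqP; split=> y /=.
    by move=> [j ->]; exists j => //=; rewrite mem_index_enum.
  by move=> [j _ ->]; exists j.
by apply: bigsetU_measurable => j _; exact: measurable_tuple1.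
Qed.

Lemma pcost_ge0 (p : R) xy : 0 <= @pcost R n p xy.
Proof. by apply: sumr_ge0 => i _; exact: powR_ge0. Qed.

Lemma pcost_refl (p : R) u : p != 0 -> pcost p (u, u) = 0.
Proof.
by move=> p0; rewrite /pcost big1 // => i _; rewrite subrr normr0 powR0.
Qed.

Lemma measurable_pcost (p : R) : measurable_fun setT (@pcost R n p).
Proof.
apply: measurable_sum => i.
apply: (measurableT_comp (measurable_powR p)).
apply: measurableT_comp => //; apply: measurable_funB.
  by apply: (measurableT_comp (measurable_tnth i)); exact: measurable_fst.
by apply: (measurableT_comp (measurable_tnth i)); exact: measurable_snd.
Qed.

(** Both directions use that powers are monotone on nonnegative extended reals; the infimum is
    nonnegative since the cost is. *)
Lemma wasserstein_le (p eps : R) (Q1 Q2 : set (n.-tuple R) -> \bar R) :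
  0 < p -> 0 <= eps -> (wasserstein p Q1 Q2 <= eps%:E)%E =
  (ereal_inf [set (\int[Pi]_xy (pcost p xy)%:E)%E
             | Pi in [set Pi | coupling Q1 Q2 Pi]] <= (eps `^ p)%:E)%E.
Proof.
move=> p0 e0; rewrite /wasserstein; set I := ereal_inf _.
have I0 : (0 <= I)%E.
  apply: le_ereal_inf_tmp => _ [Pi _ <-]; apply: integral_ge0 => xy _.
  by rewrite lee_fin pcost_ge0.
have pN0 : p != 0 by rewrite gt_eqF.
apply/idP/idP => [|] H.
  rewrite -poweR_EFin -[I]poweRe1// -(mulVf pN0) poweRrM.
  apply: gt0_ler_poweR; rewrite ?(ltW p0)// in_itv /= ?leey ?andbT//.
  exact: poweR_ge0.
have -> : eps%:E = poweR (eps `^ p)%:E p^-1.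
  by rewrite poweR_EFin -powRrM divff// powRr1.
by apply: gt0_ler_poweR; rewrite ?invr_ge0 ?(ltW p0)// in_itv /= ?leey ?andbT// lee_fin powR_ge0.
Qed.

End Transport.

(** * Duality for the ambiguity ball *)

Section WeakDuality.
Variables (R : realType) (n N : nat) (p eps rho : R) (uL uU : 'I_n -> R).
Variables (uhat : 'I_N -> n.-tuple R) (h : n.-tuple R -> R) (G : 'I_N -> R).
Hypothesis N0 : (0 < N)%N.
Hypothesis p0 : 0 < p.
Hypothesis eps0 : 0 < eps.
Hypothesis rho0 : 0 <= rho.
Hypothesis h0 : forall u, 0 <= h u.
Hypothesis mh : measurable_fun setT h.
Hypothesis uhat_box : forall j, box uL uU (uhat j).
Hypothesis hG : forall u j, box uL uU u -> h u <= rho * pcost p (u, uhat j) + G j.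

Let mult j : R := \sum_(k < N) (uhat k == uhat j)%:R.

(* Atoms of the empirical measure may coincide; on such an atom the bound
   is averaged over the samples sitting there. *)
Let avg (y : n.-tuple R) : R :=
  \sum_(j < N) G j / mult j * \1_[set uhat j] y.

(** Test [hG] at the sample itself, where the transport cost vanishes. *)
Let G_ge0 j : 0 <= G j.
Proof.
have := hG (uhat j) j (uhat_box j); rewrite pcost_refl ?gt_eqF// mulr0 add0r.
exact: le_trans.
Qed.

Let mult_gt0 j : 0 < mult j.
Proof.
rewrite /mult (bigD1 j) //= eqxx ltr_pwDl// sumr_ge0//.
Qed.

Let indicE (y u : n.-tuple R) : \1_[set u] y = (y == u)%:R :> R.
Proof. by rewrite numfun.indicE; congr ((_ : bool)%:R); apply/idP/eqP; rewrite inE. Qed.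

Let avg_ge0 y : 0 <= avg y.
Proof.
by apply: sumr_ge0 => j _; rewrite mulr_ge0// divr_ge0// ltW.
Qed.

Let measurable_avg : measurable_fun setT avg.
Proof.
apply: measurable_sum => j; apply: measurable_funM => //.
by apply: measurable_indic; exact: measurable_tuple1.
Qed.

(** Each [G j] is charged at [mult j] equal samples with weight [1 / mult j], so the total is
    unchanged. *)
Let avg_sum : \sum_(j < N) N%:R^-1 * avg (uhat j) = N%:R^-1 * \sum_(j < N) G j.
Proof.
rewrite -mulr_sumr exchange_big /=; congr (_ * _); apply: eq_bigr => j _.
rewrite -mulr_sumr (eq_bigr (fun k => (uhat k == uhat j)%:R)).
  by rewrite -/(mult j) divfK// gt_eqF.
by move=> k _; rewrite indicE.
Qed.

(** All samples equal to [uhat j] give a bound with the same transport term; average these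
    bounds. *)
Let h_le_avg u j : box uL uU u -> h u <= rho * pcost p (u, uhat j) + avg (uhat j).
Proof.
move=> ubox; rewrite -lerBlDl.
have -> : h u - rho * pcost p (u, uhat j) =
    \sum_(k < N) (h u - rho * pcost p (u, uhat j)) / mult k * \1_[set uhat k] (uhat j).
  rewrite (eq_bigr (fun k => (h u - rho * pcost p (u, uhat j)) / mult j *
     (uhat k == uhat j)%:R)).
    by rewrite -mulr_sumr -/(mult j) divfK// gt_eqF.
  move=> k _; rewrite indicE eq_sym; case: eqP => [kj|]; last by rewrite !mulr0.
  by rewrite /mult kj.
apply: ler_sum => k _; rewrite indicE; case: eqP => [->|]; last by rewrite !mulr0.
rewrite !mulr1 ler_wpM2r ?invr_ge0 ?(ltW (mult_gt0 _))//.
by rewrite lerBlDl; exact: hG.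
Qed.

Lemma weak_duality (Q : probability (n.-tuple R) R) :
  ambiguity p eps uL uU uhat Q ->
  (\int[Q]_u (h u)%:E <= (eps `^ p * rho + N%:R^-1 * \sum_(j < N) G j)%:E)%E.
Proof.
move=> [Qbox]; rewrite wasserstein_le ?(ltW eps0)// => Winf.
apply/lee_addgt0Pr => e e0.
(* A coupling within [e / (rho + 1)] of the infimum suffices: multiplied by [rho], this error stays
   below [e], also when [rho = 0]. *)
have rho1 : 0 < rho + 1 by rewrite ltr_wpDl.
have : (ereal_inf [set (\int[Pi]_xy (pcost p xy)%:E)%E
   | Pi in [set Pi | coupling Q (empirical uhat) Pi]] <
   (eps `^ p + e / (rho + 1))%:E)%E.
  by apply: le_lt_trans Winf _; rewrite lte_fin ltrDl divr_gt0.
move=> /ereal_inf_lt[_ [Pi Picpl <-] Pilt].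
have mfst : measurable_fun setT (@fst (n.-tuple R) (n.-tuple R)).
  exact: measurable_fst.
have msnd : measurable_fun setT (@snd (n.-tuple R) (n.-tuple R)).
  exact: measurable_snd.
have mEh : measurable_fun setT (EFin \o h) by exact/measurable_EFinP.
have mEavg : measurable_fun setT (EFin \o avg) by exact/measurable_EFinP.
have mEcost : measurable_fun setT (fun xy => (@pcost R n p xy)%:E).
  by apply/measurable_EFinP; exact: measurable_pcost.
have intQ : (\int[Q]_u (h u)%:E = \int[Pi]_xy (h xy.1)%:E)%E.
  rewrite -[RHS](@ge0_integral_pushforward _ _ _ _ _ _ mfst Pi setT (EFin \o h))//.
    apply: eq_measure_integral => A mA _; rewrite /pushforward /=.
    have [<- _] := Picpl A mA; congr (Pi _).
    by apply/seteqP; split=> -[x y] //= [].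
  by move=> y _; rewrite lee_fin.
(* [empirical] is a bare set function; [emp] is a probability with the same values, against which
   one can integrate. *)
have [emp [empE empint]] := discrete_probability R _ (n.-tuple R) 'I_N
    (fun _ => N%:R^-1) uhat (fun _ => ltac:(by rewrite invr_ge0))
    (ltac:(by rewrite sumr_const card_ord -[_ *+ _]mulr_natl divff// pnatr_eq0 -lt0n)).
have empirE A : empirical uhat A = emp A.
  by rewrite empE /empirical ge0_sume_distrr.
have intavg : (\int[Pi]_xy (avg xy.2)%:E = (N%:R^-1 * \sum_(j < N) G j)%:E)%E.
  rewrite -avg_sum -(empint avg)//.
  rewrite -[LHS](@ge0_integral_pushforward _ _ _ _ _ _ msnd Pi setT (EFin \o avg))//.
    apply: eq_measure_integral => A mA _; rewrite /pushforward /=.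
    have [_] := Picpl A mA; rewrite empirE => <-; congr (Pi _).
    by apply/seteqP; split=> -[x y] //= [].
  by move=> y _; rewrite lee_fin.
rewrite intQ.
apply: (@le_trans _ _ (\int[Pi]_xy (rho%:E * (pcost p xy)%:E + (avg xy.2)%:E))%E).
  apply: ae_ge0_le_integral => //.
  - by move=> xy _; rewrite lee_fin.
  - exact: (measurableT_comp mEh mfst).
  - by move=> xy _; rewrite -EFinM -EFinD lee_fin addr_ge0 ?mulr_ge0 ?pcost_ge0.
  - apply: emeasurable_funD; last exact: (measurableT_comp mEavg msnd).
    by apply: emeasurable_funM => //.
  (* The pointwise bound can fail only where the first component leaves the box or the second is no
     sample; both sets are null by the marginals. *)
  - set B1 := (~` box uL uU) `*` [set: n.-tuple R].
    set B2 := [set: n.-tuple R] `*` (~` [set y | exists j, y = uhat j]).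
    have mB := measurableC (measurable_box R n uL uU).
    have mA := measurableC (measurable_atoms R n N uhat).
    have negB1 : Pi.-negligible B1.
      apply/negligibleP; first exact: measurableX.
      apply: etrans (Picpl _ mB).1 _.
      by rewrite probability_setC ?Qbox ?subee//; exact: measurable_box.
    have negB2 : Pi.-negligible B2.
      apply/negligibleP; first exact: measurableX.
      apply: etrans (Picpl _ mA).2 _; rewrite empirE empE big1 // => j _.
      by rewrite diracE memNset ?mule0//= => -[]; exists j.
    apply: negligibleS (negligibleU negB1 negB2) => -[x y] /= nle.
    have [xB|nxB] := pselect (box uL uU x); last by left.
    right; split=> // -[j /= yj]; apply: nle => _.
    by rewrite -EFinM -EFinD lee_fin yj h_le_avg.
rewrite ge0_integralD//; first last.
- exact: (measurableT_comp mEavg msnd).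
- by move=> xy _; rewrite lee_fin.
- exact: emeasurable_funM.
- by move=> xy _; rewrite -EFinM lee_fin mulr_ge0 ?pcost_ge0.
rewrite ge0_integralZl_EFin//; last by move=> xy _; rewrite lee_fin pcost_ge0.
rewrite intavg.
apply: (@le_trans _ _ (rho%:E * (eps `^ p + e / (rho + 1))%:E +
    (N%:R^-1 * \sum_(j < N) G j)%:E)%E).
  by apply: leeD => //; apply: lee_wpmul2l => //; exact: ltW.
rewrite -EFinM -!EFinD lee_fin mulrDr [rho * _]mulrC addrAC lerD2l.
rewrite mulrCA ger_pMr// ler_pdivrMr// mul1r; lra.
Qed.

End WeakDuality.

(** [Q] has mass [lam / N] at each [v j] and [(1 - lam) / N] at each [v' j]. Sending each of these
    atoms back to sample [j] is a coupling whose cost is the left side of the last hypothesis. *)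
Lemma mixture_ambiguity (R : realType) (n N : nat) (p eps lam : R)
    (uL uU : 'I_n -> R) (uhat v v' : 'I_N -> n.-tuple R) :
  (0 < N)%N -> 0 < p -> 0 < eps -> 0 <= lam <= 1 ->
  (forall j, box uL uU (v j)) -> (forall j, box uL uU (v' j)) ->
  lam * (N%:R^-1 * \sum_(j < N) pcost p (v j, uhat j)) +
    (1 - lam) * (N%:R^-1 * \sum_(j < N) pcost p (v' j, uhat j)) <= eps `^ p ->
  exists2 Q, ambiguity p eps uL uU uhat Q &
    forall h : n.-tuple R -> R, measurable_fun setT h -> (forall u, 0 <= h u) ->
    (\int[Q]_u (h u)%:E =
     (lam * (N%:R^-1 * \sum_(j < N) h (v j)) +
      (1 - lam) * (N%:R^-1 * \sum_(j < N) h (v' j)))%:E)%E.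
Proof.
move=> N0 p0 eps0 /andP[lam0 lam1] vbox v'box costle.
pose w (jb : 'I_N * bool) : R := N%:R^-1 * (if jb.2 then lam else 1 - lam).
pose a (jb : 'I_N * bool) := if jb.2 then v jb.1 else v' jb.1.
have NV0 : (N%:R : R) != 0 by rewrite pnatr_eq0 -lt0n.
have w0 jb : 0 <= w jb.
  by rewrite mulr_ge0 ?invr_ge0//; case: ifP => _ //; rewrite subr_ge0.
have wsum (F : 'I_N * bool -> R) : \sum_jb w jb * F jb =
    lam * (N%:R^-1 * \sum_(j < N) F (j, true)) +
    (1 - lam) * (N%:R^-1 * \sum_(j < N) F (j, false)).
  rewrite (eq_bigr (fun jb => w (jb.1, jb.2) * F (jb.1, jb.2))) => [|[]//].
  rewrite -(pair_bigA _ (fun j b => w (j, b) * F (j, b))) /=.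
  rewrite !mulr_sumr -big_split /=; apply: eq_bigr => j _.
  by rewrite big_bool /w /=; ring.
have w1 : \sum_jb w jb = 1.
  rewrite (eq_bigr (fun jb => w jb * 1)) => [|jb _]; last by rewrite mulr1.
  by rewrite wsum sumr_const card_ord mulVf//; ring.
have [Q [QE Qint]] := discrete_probability R _ _ _ w a w0 w1.
have [Pi [PiE Piint]] := discrete_probability R _ _ _ w
  (fun jb => (a jb, uhat jb.1)) w0 w1.
exists Q; last by move=> h mh h0; rewrite Qint// wsum.
split.
  rewrite QE -[RHS]/(1%R%:E) -w1 -sumEFin; apply: eq_bigr => -[j b] _.
  by rewrite diracE mem_set ?mule1 // /a /=; case: b.
rewrite wasserstein_le ?(ltW eps0)//.
apply: (@le_trans _ _ (\int[Pi]_xy (pcost p xy)%:E)%E).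
  apply: ereal_inf_lbound; exists Pi => //= A mA; split.
    rewrite PiE QE; apply: eq_bigr => jb _; rewrite !diracE.
    by congr (_ * (_ : bool)%:R%:E)%E; apply/idP/idP; rewrite !inE => // -[].
  rewrite PiE /empirical.
  transitivity (\sum_(jb : 'I_N * bool) (w jb * \1_A (uhat jb.1))%:E)%E.
    apply: eq_bigr => jb _; rewrite diracE EFinM numfun.indicE.
    by congr (_ * (_ : bool)%:R%:E)%E; apply/idP/idP; rewrite !inE => // -[].
  rewrite sumEFin wsum -mulrDl addrC subrK mul1r EFinM; congr (_ * _)%E.
  by rewrite -sumEFin; apply: eq_bigr => j _; rewrite diracE numfun.indicE.
rewrite Piint; last by move=> x; exact: pcost_ge0.
  by rewrite wsum lee_fin.
exact: measurable_pcost.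
Qed.

(* [V] dominates the concave envelope of [S] at [e]; [rho] is the slope of a
   supporting line there. *)
Lemma supporting_slope (R : realType) (e V : R) (S : set (R * R)) :
  (exists2 P, S P & P.1 < e) ->
  (forall P Q lam, S P -> S Q -> 0 <= lam <= 1 ->
     lam * P.1 + (1 - lam) * Q.1 <= e -> lam * P.2 + (1 - lam) * Q.2 <= V) ->
  exists2 rho, 0 <= rho & forall P, S P -> P.2 + rho * (e - P.1) <= V.
Proof.
move=> [P0 SP0 P0e] mix.
have below P : S P -> P.1 <= e -> P.2 <= V.
  move=> SP Pe; have := mix P P 1 SP SP.
  by rewrite ler01 lexx subrr !mul0r !addr0 !mul1r; apply.
(* Seen from the point [(e, V)], slopes to the right never exceed slopes to the left: mix [P] and
   [Q] with the weight that puts the abscissa exactly at [e]. *)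
have cross P Q : S P -> S Q -> P.1 < e -> e < Q.1 ->
    (Q.2 - V) / (Q.1 - e) <= (V - P.2) / (e - P.1).
  move=> SP SQ Pe eQ; have dPQ : 0 < Q.1 - P.1 by lra.
  have := mix P Q ((Q.1 - e) / (Q.1 - P.1)) SP SQ.
  have -> : 1 - (Q.1 - e) / (Q.1 - P.1) = (e - P.1) / (Q.1 - P.1) by field; lra.
  have -> : (Q.1 - e) / (Q.1 - P.1) * P.1 + (e - P.1) / (Q.1 - P.1) * Q.1 = e.
    by field; lra.
  have lam01 : 0 <= (Q.1 - e) / (Q.1 - P.1) <= 1.
    by apply/andP; split; [apply: divr_ge0; lra | rewrite ler_pdivrMr//; lra].
  move=> /(_ lam01 (lexx e)).
  have -> : (Q.1 - e) / (Q.1 - P.1) * P.2 + (e - P.1) / (Q.1 - P.1) * Q.2 =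
            ((Q.1 - e) * P.2 + (e - P.1) * Q.2) / (Q.1 - P.1) by field; lra.
  have eQ0 : 0 < Q.1 - e by lra.
  have Pe0 : 0 < e - P.1 by lra.
  rewrite !ler_pdivrMr// mulrAC ler_pdivlMr//; nra.
(* Including [0] keeps the set nonempty when no point lies to the right of [e] and makes its
   supremum nonnegative; [P0] supplies an upper bound. *)
pose slopes : set R := [set r | r = 0 \/
  exists2 Q, S Q /\ e < Q.1 & r = (Q.2 - V) / (Q.1 - e)].
have slopes_ub P : S P -> P.1 < e -> ubound slopes ((V - P.2) / (e - P.1)).
  move=> SP Pe r [->|[Q [SQ eQ] ->]]; last exact: cross.
  by apply: divr_ge0; rewrite subr_ge0 ?(ltW Pe)//; apply: below => //; exact: ltW.
have sup_slopes : has_sup slopes.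
  by split; [exists 0; left | exists ((V - P0.2) / (e - P0.1)); exact: slopes_ub].
exists (sup slopes).
  by apply: ub_le_sup; [exact: sup_slopes.2 | left].
move=> P SP; case: (ltgtP P.1 e) => Pe.
- have : sup slopes <= (V - P.2) / (e - P.1).
    by apply: ge_sup; [exact: sup_slopes.1|exact: slopes_ub].
  by rewrite ler_pdivlMr ?subr_gt0//; lra.
- have : (P.2 - V) / (P.1 - e) <= sup slopes.
    by apply: ub_le_sup; [exact: sup_slopes.2 | right; exists P].
  rewrite ler_pdivrMr ?subr_gt0//; lra.
- by rewrite Pe subrr mulr0 addr0; apply: below => //; rewrite Pe.
Qed.

Lemma strong_duality (R : realType) (n N : nat) (p eps V : R)
    (uL uU : 'I_n -> R) (uhat : 'I_N -> n.-tuple R) (h : n.-tuple R -> R) :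
  (0 < N)%N -> 0 < p -> 0 < eps ->
  (forall u, 0 <= h u) -> measurable_fun setT h ->
  (forall j, box uL uU (uhat j)) ->
  (forall Q, ambiguity p eps uL uU uhat Q -> (\int[Q]_u (h u)%:E <= V%:E)%E) ->
  exists2 rho, 0 <= rho & forall v : 'I_N -> n.-tuple R,
    (forall j, box uL uU (v j)) ->
    eps `^ p * rho +
      N%:R^-1 * \sum_(j < N) (h (v j) - rho * pcost p (v j, uhat j)) <= V.
Proof.
move=> N0 p0 eps0 h0 mh uhat_box QV.
pose S : set (R * R) := [set P | exists2 v : 'I_N -> n.-tuple R,
  (forall j, box uL uU (v j)) &
  P = (N%:R^-1 * \sum_(j < N) pcost p (v j, uhat j),
       N%:R^-1 * \sum_(j < N) h (v j))].
have [||rho rho0 rhoS] := supporting_slope R (eps `^ p) V S.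
(* Slater point: leaving the samples in place costs nothing, strictly less than the budget. *)
- exists (N%:R^-1 * \sum_(j < N) pcost p (uhat j, uhat j),
          N%:R^-1 * \sum_(j < N) h (uhat j)); first by exists uhat.
  rewrite /= big1 ?mulr0 ?powR_gt0// => j _.
  by rewrite pcost_refl// gt_eqF.
- move=> _ _ lam [v vbox ->] [v' v'box ->] lam01 /= costle.
  have [Q Qamb Qint] := mixture_ambiguity R n N p eps lam uL uU uhat v v'
    N0 p0 eps0 lam01 vbox v'box costle.
  by have := QV Q Qamb; rewrite Qint// lee_fin.
exists rho => // v vbox.
have /= := rhoS _ (ex_intro2 _ _ v vbox erefl).
apply: le_trans; rewrite le_eqVlt; apply/orP; left; apply/eqP.
by rewrite sumrB -mulr_sumr; ring.
Qed.

(** * The finite program *)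

Section Program.
Variables (R : realType) (n N : nat) (p T C eps : R).
Variables (c d uL uU : 'I_n -> R) (uhat : 'I_N -> n.-tuple R).
Hypothesis N0 : (0 < N)%N.
Hypothesis p0 : 0 < p.
Hypothesis eps0 : 0 < eps.
Hypothesis c0 : forall i, 0 <= c i.
Hypothesis d0 : forall i, 0 <= d i.
Hypothesis C0 : 0 <= C.
Hypothesis dc : forall i i' : 'I_n, nat_of_ord i' = (nat_of_ord i).+1 ->
  d i' - d i <= c i'.
Hypothesis uhat_box : forall j, box uL uU (uhat j).

Definition reward rho i l j si t : R :=
  pi_coef c d C i l * (t - si) - rho * `|t - tnth (uhat j) i| `^ p.

(* [Cell rho i l j si z] stands for the constraints that tie [z i l j] to
   [rho] and [s i]; it must describe the epigraph of the largest reward. *)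
Variable Cell : R -> 'I_n -> 'I_n.+1 -> 'I_N -> R -> R -> Prop.
Hypothesis cell_sound : forall rho i l j si z t, 0 <= rho ->
  Cell rho i l j si z -> uL i <= t <= uU i -> reward rho i l j si t <= z.
Hypothesis cell_tight : forall rho i l j si, 0 <= rho ->
  exists2 t, uL i <= t <= uU i & Cell rho i l j si (reward rho i l j si t).

Definition program_feasible rho (s : 'I_n -> R) (gam : 'I_n -> 'I_N -> R)
    (z : 'I_n -> 'I_n.+1 -> 'I_N -> R) : Prop :=
  (forall (i : 'I_n) (l : 'I_n.+1) (j : 'I_N), (i <= l)%N ->
     \sum_(k < n | (i <= k <= l)%N) z k l j <=
       \sum_(k < n | (i <= k <= l)%N) gam k j /\
     Cell rho i l j (s i) (z i l j)) /\
  0 <= rho /\ schedules T s.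

Definition program_obj rho (gam : 'I_n -> 'I_N -> R) : R :=
  eps `^ p * rho + (N%:R)^-1 * \sum_(j < N) \sum_(i < n) gam i j.

Let fcost' := fcost c d C.

(** Take a partition that attains the cost at [u]. Each coordinate's reward is at most [z] by
    [cell_sound], and [partition_bound] passes from [z] to [gam]. *)
Lemma program_bound rho s gam z u j : program_feasible rho s gam z ->
  box uL uU u -> fcost' s u <= rho * pcost p (u, uhat j) + \sum_(i < n) gam i j.
Proof.
move=> [feas [rho0 _]] ubox; rewrite -lerBlDl.
have [E fE] := fcost_blocks R n c d C d0 C0 dc s u.
pose pen := extend R n (fun i => `|tnth u i - tnth (uhat j) i| `^ p) 0.
pose Z k l := price R n c d C k l * excess R n s u k - rho * pen k.
have -> : fcost' s u - rho * pcost p (u, uhat j) =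
    \sum_(0 <= k < n) Z k (block_end n E k).
  rewrite sumrB -fE -mulr_sumr big_mkord; congr (_ - _ * _).
  by apply: eq_bigr => i _; rewrite /pen extend_ord.
have -> : \sum_(i < n) gam i j =
    \sum_(0 <= k < n) extend R n (fun i => gam i j) 0 k.
  by rewrite big_mkord; apply: eq_bigr => i _; rewrite extend_ord.
apply: partition_bound => i l /andP[il ln] iltn.
rewrite -(sum_block R n (fun k => Z k l)) -sum_block.
pose l' : 'I_n.+1 := Ordinal (ln : (l < n.+1)%N).
apply: (@le_trans _ _ (\sum_(k < n | (i <= k <= l)%N) z k l' j)).
  apply: ler_sum => k /andP[_ kl].
  have [_ cell] := feas k l' j kl.
  apply: le_trans (cell_sound _ _ _ _ _ _ (tnth u k) rho0 cell (ubox k)).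
  by rewrite /Z /reward /pen /excess !extend_ord -(pi_coefE R n c d C k l' kl).
have [le_gam _] := feas (Ordinal iltn) l' j il.
apply: le_trans le_gam _; rewrite le_eqVlt; apply/orP; left; apply/eqP.
by apply: eq_bigr => k _; rewrite extend_ord.
Qed.

(** The penalised cost separates over coordinates once the partition is fixed, so a worst scenario
    for sample [j] is assembled from the one-dimensional maximisers [t] along a longest path. *)
Lemma program_tight rho s : 0 <= rho -> schedules T s ->
  exists gam z (v : 'I_N -> n.-tuple R),
  [/\ program_feasible rho s gam z, forall j, box uL uU (v j) &
      forall j, \sum_(i < n) gam i j <= fcost' s (v j) - rho * pcost p (v j, uhat j)].
Proof.
move=> rho0 sT.
have /choice[t tP] : forall x : 'I_n * 'I_n.+1 * 'I_N, exists t,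
    uL x.1.1 <= t <= uU x.1.1 /\
    Cell rho x.1.1 x.1.2 x.2 (s x.1.1) (reward rho x.1.1 x.1.2 x.2 (s x.1.1) t).
  move=> [[i l] j]; have [t ti tC] := cell_tight rho i l j (s i) rho0.
  by exists t.
pose z i l j := reward rho i l j (s i) (t (i, l, j)).
pose Z j k l := extend R n (fun i => z i (inord l) j) 0 k.
have /choice[E EP] : forall j, exists E, exists g : nat -> R,
    (forall i l, (i <= l <= n)%N ->
      \sum_(i <= k < minn l.+1 n) Z j k l <= \sum_(i <= k < minn l.+1 n) g k) /\
    \sum_(0 <= k < n) g k = \sum_(0 <= k < n) Z j k (block_end n E k).
  by move=> j; exact: partition_potential.
have {EP}/choice[g gP] := EP.
exists (fun i j => g j i), z,
  (fun j => [tuple t (i, inord (block_end n (E j) i), j) | i < n]).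
split=> [|j i|j].
- split=> [i l j il|//]; split; last by have [] := tP (i, l, j).
  have [gZ _] := gP j; have := gZ i l; rewrite -!sum_block il -ltnS ltn_ord.
  move=> /(_ isT); apply: le_trans; rewrite le_eqVlt; apply/orP; left; apply/eqP.
  by apply: eq_bigr => k _; rewrite /Z extend_ord inord_val.
- by rewrite tnth_mktuple; have [] := tP (i, inord (block_end n (E j) i), j).
- have [_] := gP j; rewrite big_mkord => ->; rewrite lerBrDr.
  have := fcost_ge_blocks R n c d C d0 C0 dc s
    [tuple t (i, inord (block_end n (E j) i), j) | i < n] (E j).
  apply: le_trans; rewrite le_eqVlt; apply/orP; left; apply/eqP.
  rewrite /pcost mulr_sumr !big_mkord -big_split /=; apply: eq_bigr => k _.
  rewrite /Z extend_ord /z /reward /excess !extend_ord !tnth_mktuple subrK.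
  have kE : (block_end n (E j) k <= n)%N by apply: block_end_le; exact: ltnW.
  by rewrite pi_coefE inordK// block_end_ge.
Qed.

Lemma wdras_obj_le rho s gam z : program_feasible rho s gam z ->
  (wdras_obj c d C p eps uL uU uhat s <= (program_obj rho gam)%:E)%E.
Proof.
move=> feas; apply: ge_ereal_sup => _ [Q Qamb <-].
apply: (weak_duality R n N p eps rho uL uU) => //.
- by case: feas => _ [].
- by move=> u; exact: fcost_ge0.
- exact: measurable_fcost.
- by move=> u j ubox; exact: program_bound feas ubox.
Qed.

Lemma wdras_obj_attained s : schedules T s -> exists rho gam z,
  program_feasible rho s gam z /\
  ((program_obj rho gam)%:E <= wdras_obj c d C p eps uL uU uhat s)%E.
Proof.
move=> sT.
have h0 u : 0 <= fcost' s u by exact: fcost_ge0.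
have mh : measurable_fun setT (fcost' s) by exact: measurable_fcost.
(* The worst-case expectation is finite: the program at [rho = 0] bounds it above, and the ball
   contains a distribution, the unmoved samples, so it is at least [0]. *)
have [gam1 [z1 [v1 [feas1 _ _]]]] := program_tight 0 s (lexx 0) sT.
have Wlt := wdras_obj_le _ _ _ _ feas1.
have [Q Qamb _] := mixture_ambiguity R n N p eps 1 uL uU uhat uhat uhat N0 p0 eps0
  (ltac:(by rewrite ler01 lexx)) uhat_box uhat_box
  (ltac:(by rewrite big1 => [|j _]; [rewrite !mulr0 addr0 powR_ge0 |
     rewrite pcost_refl// gt_eqF])).
have W0 : (0 <= wdras_obj c d C p eps uL uU uhat s)%E.
  apply: (@le_trans _ _ (\int[Q]_u (fcost' s u)%:E)%E).
    by apply: integral_ge0 => u _; rewrite lee_fin.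
  by apply: ereal_sup_ubound; exists Q.
have [V WV] : exists V, wdras_obj c d C p eps uL uU uhat s = V%:E.
  move: Wlt W0; case: (wdras_obj _ _ _ _ _ _ _ _ _) => [V _ _| |] //.
  by exists V.
have [rho rho0 rhoV] := strong_duality R n N p eps V uL uU uhat (fcost' s)
  N0 p0 eps0 h0 mh uhat_box
  (fun Q Qamb => ltac:(by rewrite -WV; apply: ereal_sup_ubound; exists Q)).
have [gam [z [v [feas vbox gamle]]]] := program_tight rho s rho0 sT.
exists rho, gam, z; split=> //; rewrite WV lee_fin.
apply: le_trans (rhoV v vbox); rewrite lerD2l ler_wpM2l ?invr_ge0//.
exact: ler_sum.
Qed.

(** For each [s] the program minimised over the other variables attains [wdras_obj], by the two
    preceding lemmas; hence minimising over [s] gives equal values and equal minimisers. *)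
Lemma wdras_program :
  let values s := [set y | exists rho gam z,
    program_feasible rho s gam z /\ y = (program_obj rho gam)%:E] in
  let value := ereal_inf [set y | exists s, values s y] in
  wdras_value c d C p eps uL uU uhat T = value /\
  wdras_optimal c d C p eps uL uU uhat T = [set s | values s value].
Proof.
move=> values value.
have valueE : wdras_value c d C p eps uL uU uhat T = value.
  apply/eqP; rewrite eq_le; apply/andP; split.
    apply: le_ereal_inf_tmp => _ [s [rho [gam [z [feas ->]]]]].
    apply: le_trans (wdras_obj_le _ _ _ _ feas).
    by apply: ereal_inf_lbound; exists s => //; case: feas => _ [].
  apply: le_ereal_inf_tmp => _ [s sT <-].
  have [rho [gam [z [feas leW]]]] := wdras_obj_attained s sT.
  by apply: le_trans leW; apply: ereal_inf_lbound; exists s, rho, gam, z.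
split=> //; apply/seteqP; split=> s.
  move=> [sT sE]; have [rho [gam [z [feas leW]]]] := wdras_obj_attained s sT.
  exists rho, gam, z; split=> //; apply/eqP; rewrite eq_le; apply/andP; split.
    by apply: ereal_inf_lbound; exists s, rho, gam, z.
  by rewrite -valueE -sE.
move=> [rho [gam [z [feas vE]]]]; have sT : schedules T s by case: feas => _ [].
split=> //; apply/eqP; rewrite eq_le; apply/andP; split.
  by rewrite valueE vE; exact: wdras_obj_le feas.
by apply: ereal_inf_lbound; exists s.
Qed.
End Program.

(** * Linear and conic epigraphs of the one-dimensional rewards *)

Section Cells.
Variables (R : realType) (n N : nat) (C : R) (c d uL uU : 'I_n -> R).
Variable uhat : 'I_N -> n.-tuple R.
Hypothesis uhat_box : forall j, box uL uU (uhat j).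
Implicit Types (rho si z t : R) (i : 'I_n) (l : 'I_n.+1) (j : 'I_N).

Let pc := pi_coef c d C.

Definition lp_cell rho i l j si z : Prop :=
  [/\ z + pc i l * si + `|uL i - tnth (uhat j) i| * rho >= pc i l * uL i,
      z + pc i l * si >= pc i l * tnth (uhat j) i &
      z + pc i l * si + `|uU i - tnth (uhat j) i| * rho >= pc i l * uU i].

Let reward1E rho i l j si t : reward R n N 1 C c d uhat rho i l j si t =
  pc i l * (t - si) - rho * `|t - tnth (uhat j) i|.
Proof. by rewrite /reward powRr1. Qed.

(** The reward is affine on either side of the sample, so it is largest at [uL i], at the sample or
    at [uU i]; these are the three constraints. *)
Lemma lp_cell_sound rho i l j si z t : 0 <= rho -> lp_cell rho i l j si z ->
  uL i <= t <= uU i -> reward R n N 1 C c d uhat rho i l j si t <= z.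
Proof.
move=> rho0 []; have /andP[Lu uU_] := uhat_box j i.
rewrite reward1E; set k := pc i l; set u := tnth (uhat j) i in Lu uU_ *.
rewrite ler0_norm ?subr_le0// ger0_norm ?subr_ge0// => HL Hu HU /andP[Lt tU].
case: (leP t u) => tu.
  rewrite ler0_norm ?subr_le0//.
  case: (leP 0 (k + rho)) => kr; nra.
rewrite gtr0_norm ?subr_gt0//.
case: (leP 0 (k - rho)) => kr; nra.
Qed.

Lemma lp_cell_tight rho i l j si : 0 <= rho ->
  exists2 t, uL i <= t <= uU i &
    lp_cell rho i l j si (reward R n N 1 C c d uhat rho i l j si t).
Proof.
move=> rho0; have /andP[Lu uU_] := uhat_box j i.
have LU := le_trans Lu uU_.
pose k := pc i l; pose u := tnth (uhat j) i; rewrite -/u in Lu uU_.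
suff [t tI [HL Hu HU]] : exists2 t, uL i <= t <= uU i &
    let z := k * (t - si) - rho * `|t - u| in
    [/\ k * uL i <= z + k * si + (u - uL i) * rho, k * u <= z + k * si
      & k * uU i <= z + k * si + (uU i - u) * rho].
  exists t => //; rewrite reward1E /lp_cell -/k -/u.
  by rewrite (ler0_norm (x := uL i - u)) ?subr_le0// opprB
     (ger0_norm (x := uU i - u)) ?subr_ge0.
(* The slopes are [k + rho] left of [u] and [k - rho] right of it; their signs locate the
   maximiser. *)
case: (ltP rho k) => [rk|kr].
  exists (uU i); first by rewrite LU lexx.
  by rewrite ger0_norm ?subr_ge0//; split; nra.
case: (ltP k (- rho)) => [rk|kr'].
  exists (uL i); first by rewrite LU lexx.
  by rewrite ler0_norm ?subr_le0//; split; nra.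
exists u; first by rewrite Lu.
by rewrite subrr normr0; split; nra.
Qed.

(** The rotated cone: square both sides and use [(r + rho) ^+ 2 - (r - rho) ^+ 2 = 4 * r * rho]. *)
Lemma soc_le (x r rho : R) : 0 <= rho ->
  (Num.sqrt (x ^+ 2 + (r - rho) ^+ 2) <= r + rho) =
  (0 <= r) && (x ^+ 2 <= 4 * r * rho).
Proof.
move=> rho0.
have S0 : 0 <= x ^+ 2 + (r - rho) ^+ 2 by rewrite addr_ge0// sqr_ge0.
have x20 : 0 <= x ^+ 2 by rewrite sqr_ge0.
apply/idP/andP => [H|[r0 H]].
  have rr0 : 0 <= r + rho by apply: le_trans H; exact: sqrtr_ge0.
  have : Num.sqrt (x ^+ 2 + (r - rho) ^+ 2) ^+ 2 <= (r + rho) ^+ 2.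
    by rewrite ler_sqr ?nnegrE ?sqrtr_ge0.
  rewrite sqr_sqrtr// => H2; have xr : x ^+ 2 <= 4 * r * rho by nra.
  (* If [r < 0], then [rho > 0] because [r + rho] is nonnegative, and [4 * r * rho] would be
     negative. *)
  split=> //; rewrite leNgt; apply/negP => r0; nra.
rewrite -[leRHS]ger0_norm ?addr_ge0// -sqrtr_sqr ler_wsqrtr//; nra.
Qed.

(** The triple [b] packs the lower multiplier, the upper multiplier and [r], so that one use of
    [choice] extracts all three. *)
Definition socp_constraints rho i l j si z (b : R * R * R) : Prop :=
  [/\ z + pc i l * si - (uU i - tnth (uhat j) i) * b.1.2
        - (tnth (uhat j) i - uL i) * b.1.1 - b.2 >= pc i l * tnth (uhat j) i,
      Num.sqrt ((pc i l + b.1.1 - b.1.2) ^+ 2 + (b.2 - rho) ^+ 2) <= b.2 + rho,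
      0 <= b.1.1 & 0 <= b.1.2].

Definition socp_cell rho i l j si z : Prop :=
  exists b, socp_constraints rho i l j si z b.

Let reward2E rho i l j si t : reward R n N 2 C c d uhat rho i l j si t =
  pc i l * (t - si) - rho * (t - tnth (uhat j) i) ^+ 2.
Proof. by rewrite /reward powR_mulrn// real_normK ?num_real. Qed.

(* Weak duality for the box-constrained concave quadratic in [t]. *)
Lemma socp_cell_sound rho i l j si z t : 0 <= rho -> socp_cell rho i l j si z ->
  uL i <= t <= uU i -> reward R n N 2 C c d uhat rho i l j si t <= z.
Proof.
move=> rho0 [[[bL bU] r]]; rewrite /socp_constraints /= soc_le// reward2E.
set k := pc i l; set u := tnth (uhat j) i => -[Hz /andP[r0 Hx] bL0 bU0] /andP[Lt tU].
(* Complete the square after scaling by [4 * rho]; at [rho = 0] the cone forces the linear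
   coefficient to vanish. *)
have Hr : (k + bL - bU) * (t - u) - rho * (t - u) ^+ 2 <= r.
  move: rho0; rewrite le_eqVlt => /predU1P[rhoE|rho0].
    move: Hx; rewrite -rhoE mulr0 mul0r subr0 => Hx.
    have /eqP : (k + bL - bU) ^+ 2 = 0 by apply/eqP; rewrite eq_le Hx sqr_ge0.
    by rewrite sqrf_eq0 => /eqP ->; rewrite mul0r.
  rewrite -(ler_pM2l (x := 4 * rho)); last by rewrite mulr_gt0.
  move: Hx; set x := k + bL - bU; set y := t - u => Hx.
  have := sqr_ge0 (x - 2 * rho * y); lra.
have HU : bU * (t - u) <= bU * (uU i - u) by rewrite ler_wpM2l// lerB.
have HL : bL * (u - t) <= bL * (u - uL i) by rewrite ler_wpM2l// lerB.
nra.
Qed.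

(** The maximiser is [u + k / (2 * rho)] clamped to the interval. By the optimality conditions the
    multiplier of an active bound is the leftover derivative there, and [r] is
    [rho * (t - u) ^+ 2]. *)
Lemma socp_cell_tight rho i l j si : 0 <= rho ->
  exists2 t, uL i <= t <= uU i &
    socp_cell rho i l j si (reward R n N 2 C c d uhat rho i l j si t).
Proof.
move=> rho0; have /andP[] := uhat_box j i.
set u := tnth (uhat j) i => Lu uU_; pose k := pc i l.
have LU := le_trans Lu uU_.
case: (leP (2 * rho * (uU i - u)) k) => [kU|kU].
  exists (uU i); first by rewrite LU lexx.
  rewrite reward2E; exists (0, k - 2 * rho * (uU i - u), rho * (uU i - u) ^+ 2).
  rewrite /socp_constraints -/k -/u /=.
  split=> //; [nra| |by rewrite subr_ge0].
  rewrite soc_le// mulr_ge0 ?sqr_ge0//=; nra.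
case: (leP k (- (2 * rho * (u - uL i)))) => [kL|kL].
  exists (uL i); first by rewrite LU lexx.
  rewrite reward2E; exists (- k - 2 * rho * (u - uL i), 0, rho * (u - uL i) ^+ 2).
  rewrite /socp_constraints -/k -/u /=.
  split=> //; [nra| |lra].
  rewrite soc_le// mulr_ge0 ?sqr_ge0//=; nra.
(* With [rho = 0] the two remaining inequalities would give both [k < 0] and [0 < k]. *)
have rho_gt0 : 0 < rho.
  by move: rho0; rewrite le_eqVlt => /predU1P[rhoE|//]; move: kU kL; rewrite -rhoE; lra.
have rhoN0 : rho != 0 by rewrite gt_eqF.
have r20 : 0 < 2 * rho by rewrite mulr_gt0.
exists (u + k / (2 * rho)).
  apply/andP; split; first by rewrite -lerBlDl ler_pdivlMr//; lra.
  by rewrite -lerBrDl ler_pdivrMr//; lra.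
rewrite reward2E; exists (0, 0, k ^+ 2 / (4 * rho)).
rewrite /socp_constraints -/k -/u /=; split=> //.
  rewrite le_eqVlt; apply/orP; left; apply/eqP; field; lra.
rewrite soc_le// divr_ge0 ?sqr_ge0 ?mulr_ge0//= le_eqVlt.
by apply/orP; left; apply/eqP; field; lra.
Qed.

End Cells.

(** Both programs are instances of [wdras_program], with [lp_cell] and [socp_cell] as cells; what
    remains is to match feasible sets and objectives. *)
Theorem theorem4 (R : realType) (n N : nat) (T C eps : R)
    (c d uL uU : 'I_n -> R) (uhat : 'I_N -> n.-tuple R) :
  (0 < n)%N -> (0 < N)%N -> 0 < T ->
  (forall i, 0 <= c i) -> (forall i, 0 <= d i) -> 0 <= C ->
  (forall i i' : 'I_n, nat_of_ord i' = (nat_of_ord i).+1 -> d i' - d i <= c i') ->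
  (forall i, 0 <= uL i < uU i) ->
  (forall j, box uL uU (uhat j)) ->
  0 < eps ->
  (wdras_value c d C 1 eps uL uU uhat T = lp1_value c d C T uL uU uhat eps /\
   wdras_optimal c d C 1 eps uL uU uhat T = lp1_optimal c d C T uL uU uhat eps) /\
  (wdras_value c d C 2 eps uL uU uhat T = socp2_value c d C T uL uU uhat eps /\
   wdras_optimal c d C 2 eps uL uU uhat T = socp2_optimal c d C T uL uU uhat eps).
Proof.
move=> _ N0 _ c0 d0 C0 dc _ uhat_box eps0; split.
- have [] := wdras_program R n N 1 T C eps c d uL uU uhat N0 ltr01 eps0
    c0 d0 C0 dc uhat_box (lp_cell R n N C c d uL uU uhat)
    (lp_cell_sound R n N C c d uL uU uhat uhat_box)
    (lp_cell_tight R n N C c d uL uU uhat uhat_box).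
  have objE rho gam : program_obj R n N 1 eps rho gam = lp1_obj eps rho gam.
    by rewrite /program_obj powRr1// ltW.
  have feasE rho s gam z : program_feasible R n N T (lp_cell R n N C c d uL uU uhat)
      rho s gam z <-> lp1_feasible c d C T uL uU uhat rho s gam z.
    by split=> -[feas rest]; split=> // i l j /(feas i l j); [case=> ? [] | case].
  have valueE : ereal_inf [set y | exists s rho gam z,
      program_feasible R n N T (lp_cell R n N C c d uL uU uhat) rho s gam z /\
      y = (program_obj R n N 1 eps rho gam)%:E] = lp1_value c d C T uL uU uhat eps.
    congr ereal_inf; apply/seteqP; split=> y.
      by move=> [s [rho [gam [z [/feasE ? ->]]]]]; exists rho, s, gam, z; rewrite objE.
    by move=> [rho [s [gam [z [/feasE ? ->]]]]]; exists s, rho, gam, z; rewrite objE.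
  rewrite valueE => -> ->; split=> //; apply/seteqP; split=> s [rho [gam [z []]]].
    by move=> /feasE feas vE; exists rho, gam, z; rewrite vE objE.
  by move=> /feasE feas vE; exists rho, gam, z; rewrite objE vE.
- have [] := wdras_program R n N 2 T C eps c d uL uU uhat N0 (ltr0n _ 2) eps0
    c0 d0 C0 dc uhat_box (socp_cell R n N C c d uL uU uhat)
    (socp_cell_sound R n N C c d uL uU uhat)
    (socp_cell_tight R n N C c d uL uU uhat uhat_box).
  have objE rho gam : program_obj R n N 2 eps rho gam = socp2_obj eps rho gam.
    by rewrite /program_obj powR_mulrn// ltW.
  have feasE rho s gam z : program_feasible R n N T (socp_cell R n N C c d uL uU uhat)
      rho s gam z <-> exists bL bU r,
      socp2_feasible c d C T uL uU uhat rho s gam z bL bU r.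
    split=> [[feas rest]|[bL [bU [r [feas rest]]]]]; last first.
      split=> // i l j /(feas i l j) [? ? ? ? ?]; split=> //.
      by exists (bL i l j, bU i l j, r i l j).
    (* The cell hides its multipliers under an existential; for [l < i] nothing is required and
       zeros are used. *)
    have /choice[b bP] : forall x : 'I_n * 'I_n.+1 * 'I_N, exists b,
        (x.1.1 <= x.1.2)%N -> socp_constraints R n N C c d uL uU uhat rho
          x.1.1 x.1.2 x.2 (s x.1.1) (z x.1.1 x.1.2 x.2) b.
      move=> [[i l] j] /=; have [il|_] := leqP i l; last by exists (0, 0, 0).
      by have [_ [b bP]] := feas i l j il; exists b.
    exists (fun i l j => (b (i, l, j)).1.1), (fun i l j => (b (i, l, j)).1.2),
      (fun i l j => (b (i, l, j)).2); split=> // i l j il.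
    have [? _] := feas i l j il; have [? ? ? ?] := bP (i, l, j) il.
    by split.
  have valueE : ereal_inf [set y | exists s rho gam z,
      program_feasible R n N T (socp_cell R n N C c d uL uU uhat) rho s gam z /\
      y = (program_obj R n N 2 eps rho gam)%:E] = socp2_value c d C T uL uU uhat eps.
    congr ereal_inf; apply/seteqP; split=> y.
      move=> [s [rho [gam [z [/feasE[bL [bU [r ?]]] ->]]]]].
      by exists rho, s, gam, z, bL, bU, r; rewrite objE.
    move=> [rho [s [gam [z [bL [bU [r [? ->]]]]]]]].
    by exists s, rho, gam, z; rewrite objE; split=> //; apply/feasE; exists bL, bU, r.
  rewrite valueE => -> ->; split=> //; apply/seteqP; split=> s [rho [gam [z]]].
    move=> [/feasE[bL [bU [r feas]]] vE].
    by exists rho, gam, z, bL, bU, r; rewrite vE objE.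
  move=> [bL [bU [r [feas vE]]]]; exists rho, gam, z; rewrite objE vE; split=> //.
  by apply/feasE; exists bL, bU, r.
Qed.
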